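(* For all integers $n\ge 1$, $k\ge 0$ and $p$, $$N_E(n,k,p)=\frac{n}{k+1}\,N_k^{n,p}.$$
   Context: A lattice path of length $n$ here is a path in the plane starting at the origin $(0,0)$ and consisting of $n$ unit steps, each either E $=(1,0)$ or N $=(0,1)$. For integers $n\ge 1$, $k\ge 0$, $r$, $s$, let $M_{r,s}^{n,k}$ be the number of ordered pairs of lattice paths of length $n$ such that the first path ends at $(r,n-r)$, the second path ends at $(s,n-s)$, and the two paths intersect exactly $k$ times, where intersections at the origin and at the endpoints of the paths are not counted; that is, there are exactly $k$ indices $m$ with $1\le m\le n-1$ such that the two paths are at the same lattice point after $m$ steps. ($M_{r,s}^{n,k}=0$ unless $0\le r,s\le n$.) Put $N_k^{n,r}=M_{r,r}^{n,k}$. For an integer $p$ define $$N_E(n,k,p)=\sum_{r+s=2p} M_{r,s}^{n,k},$$ where the sum is over all ordered pairs of integers $(r,s)$ with $0\le r,s\le n$ and $r+s=2p$. *)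

(* Defs.v *)
From HB Require Import structures.
From mathcomp Require Import all_boot all_order all_algebra.

Set Implicit Arguments.
Unset Strict Implicit.
Unset Printing Implicit Defensive.

Import Order.TTheory GRing.Theory Num.Theory.
Local Open Scope ring_scope.

(* A lattice path of length n is its sequence of n unit steps, where [true]
   encodes E = (1, 0) and [false] encodes N = (0, 1). *)
Definition lattice_path (n : nat) := n.-tuple bool.

Definition step (b : bool) : int * int := if b then (1, 0) else (0, 1).

(* The lattice point reached from the origin after the first m steps. *)
Definition position (n : nat) (P : lattice_path n) (m : nat) : int * int :=
  \sum_(b <- take m P) step b.

(* Only the indices 1 <= m <= n - 1 count. *)
Definition intersections (n : nat) (P Q : lattice_path n) : nat :=
  #|[set m : 'I_n | (0 < m)%N && (position P m == position Q m)]|.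

Definition M (n k : nat) (r s : int) : nat :=
  #|[set PQ : lattice_path n * lattice_path n |
      [&& position PQ.1 n == (r, n%:Z - r),
          position PQ.2 n == (s, n%:Z - s)
        & intersections PQ.1 PQ.2 == k]]|.

Definition N_same (n k : nat) (r : int) : nat := M n k r r.

Definition N_E (n k : nat) (p : int) : nat :=
  (\sum_(r < n.+1) \sum_(s < n.+1 | (r%:Z + s%:Z == 2 * p)%R) M n k r s)%N.

(* Main.v *)
Require Import Defs.
From mathcomp Require Import all_boot all_order all_algebra.
From mathcomp Require Import zify ring.

Import Order.TTheory GRing.Theory Num.Theory.
Local Open Scope ring_scope.

(* Record a pair of paths by the difference of their numbers of E steps: a walk on
   the integers with steps 0 (weight a = 1 + t^2) and 1, -1 (weight b = t each),
   where t marks the total number of E steps.  Meetings are the zeros of the walk,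
   the pairs counted by N_k end at 0, and those counted by N_E end at an even
   point.  The identity holds for arbitrary weights a and b.

   Let c_n(d), written kernel n d, be the coefficient of u^d in
   (a + b (u + 1/u))^n.  By reflection, walks from d > 0 first reaching 0 at time
   n + 1 have weight b (c_n(d-1) - c_n(d+1)), and those that stay positive for n
   steps and end at an even point have weight c_n(d) + c_n(d-2) + ... + c_n(2-d).
   With d = 1 and the identity d c_{n+1}(d) = (n+1) b (c_n(d-1) - c_n(d+1)), this
   is the case k = 0.  If H(x) is the generating function of first returns to 0,
   the case k = 0 says that walks with no interior zero and even end have
   generating function x H', so the general case reads
   (k+1) H^k x H' = x (H^(k+1))'. *)

(** * Weighted walks on the integers, sorted by their zeros *)

Section WeightedWalk.
Variables (R : comNzRingType) (a b : R).

Definition transfer (f : int -> R) (d : int) : R :=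
  a * f d + b * (f (d + 1) + f (d - 1)).

Lemma eq_transfer (f g : int -> R) (d : int) :
  f =1 g -> transfer f d = transfer g d.
Proof. by move=> fg; rewrite /transfer !fg. Qed.

Lemma transferN (f : int -> R) (d : int) :
  transfer f (- d) = transfer (fun x => f (- x)) d.
Proof. by rewrite /transfer !opprD opprK [f (- d - 1) + _]addrC. Qed.

(* Total weight of the n-step walks started at d with exactly k zeros strictly
   between the two ends and an endpoint satisfying e. *)
Fixpoint walk (e : pred int) (k n : nat) (d : int) : R :=
  if n is n'.+1 then
    transfer (fun d' => if (0 < n')%N && (d' == 0)
                       then (if k is k'.+1 then walk e k' n' 0 else 0)
                       else walk e k n' d') d
  else ((k == 0%N) && e d)%:R.

(** The state just after a step: unlike in [walk], a starting point 0 with steps left counts as an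
    interior zero. *)
Definition next_walk (e : pred int) (k n : nat) (d : int) : R :=
  if (0 < n)%N && (d == 0) then (if k is k'.+1 then walk e k' n 0 else 0)
  else walk e k n d.

Lemma walk0 (e : pred int) (k : nat) (d : int) :
  walk e k 0 d = ((k == 0%N) && e d)%:R.
Proof. by []. Qed.

Lemma walkS (e : pred int) (k n : nat) (d : int) :
  walk e k n.+1 d = transfer (next_walk e k n) d.
Proof. by []. Qed.

Arguments walk : simpl never.

(** * Walks with no condition on their zeros *)

Fixpoint kernel (n : nat) (d : int) : R :=
  if n is n'.+1 then transfer (kernel n') d else (d == 0)%:R.

Lemma kernel0 (d : int) : kernel 0 d = (d == 0)%:R.
Proof. by []. Qed.

Lemma kernelS (n : nat) (d : int) :
  kernel n.+1 d = a * kernel n d + b * (kernel n (d + 1) + kernel n (d - 1)).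
Proof. by []. Qed.

Arguments kernel : simpl never.

Lemma kernelN (n : nat) (d : int) : kernel n (- d) = kernel n d.
Proof.
elim: n d => [|n IHn] d; first by rewrite !kernel0 oppr_eq0.
by rewrite !kernelS -!/(transfer _ _) transferN; apply: eq_transfer.
Qed.

(* Apply u d/du to (a + b (u + 1/u))^(n+1) and take the coefficient of u^d. *)
Lemma mulr_kernel (n : nat) (d : int) :
  d%:~R * kernel n.+1 d
    = n.+1%:R * (b * (kernel n (d - 1) - kernel n (d + 1))).
Proof.
elim: n d => [|n IHn] d.
  rewrite kernelS !kernel0.
  have [->|d0] := eqVneq d 0.
    by rewrite sub0r add0r oppr_eq0 /= mulr0z mul0r subrr !mulr0.
  have [->|d1] := eqVneq d 1.
    by rewrite /= mulr1z !mul1r mulr0 !add0r subr0.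
  have [->|dN1] := eqVneq d (-1).
    by rewrite /= mulrNz mulr1z mulN1r mul1r mulr0 add0r addr0 sub0r mulrN.
  have -> : (d + 1 == 0) = false by lia.
  have -> : (d - 1 == 0) = false by lia.
  by rewrite /= addr0 subr0 !mulr0 addr0 !mulr0.
have E1 := IHn d; have E2 := IHn (d - 1); have E3 := IHn (d + 1).
(* Trading the factor [d] for [d + 1] and [d - 1] at the neighbours lets the induction hypotheses
   apply; the correction is the last summand, which raises [n.+1] to [n.+2]. *)
have -> : d%:~R * kernel n.+2 d = a * (d%:~R * kernel n.+1 d)
   + b * ((d + 1)%:~R * kernel n.+1 (d + 1) + (d - 1)%:~R * kernel n.+1 (d - 1))
   + b * (kernel n.+1 (d - 1) - kernel n.+1 (d + 1)).
  by rewrite kernelS; ring.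
rewrite E1 E2 E3 !kernelS.
have -> : d - 1 + 1 = d by ring.
have -> : d + 1 - 1 = d by ring.
ring.
Qed.

(** * Symmetry, first returns and reflection *)

Lemma walkN (e : pred int) (k n : nat) (d : int) :
  (forall x, e (- x) = e x) -> walk e k n (- d) = walk e k n d.
Proof.
move=> eN; elim: n d => [|n IHn] d; first by rewrite !walk0 eN.
rewrite !walkS transferN; apply: eq_transfer => x.
by rewrite /next_walk oppr_eq0 IHn.
Qed.

Lemma walk_step0 (e : pred int) (n : nat) : (forall x, e (- x) = e x) ->
  walk e 0 n.+2 0 = b * walk e 0 n.+1 1 *+ 2.
Proof.
move=> eN; rewrite walkS /transfer /next_walk /= mulr0 !add0r.
by rewrite walkN // -mulr2n mulrnAr.
Qed.

Lemma walk_stepS (e : pred int) (n d : nat) :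
  walk e 0 n.+1 d.+1%:Z = a * walk e 0 n d.+1%:Z
    + b * (walk e 0 n d.+2%:Z + next_walk e 0 n d%:Z).
Proof.
rewrite walkS /transfer.
have -> : d.+1%:Z + 1 = d.+2 by lia.
have -> : d.+1%:Z - 1 = d by lia.
by rewrite /next_walk !andbF.
Qed.

Definition first_return (n : nat) (d : int) : R := walk (pred1 0) 0 n d.

(** Cut the walk at its first interior zero, reached at time [m.+1]. *)
Lemma walk_first_return (e : pred int) (k n : nat) (d : int) :
  walk e k.+1 n.+1 d
    = \sum_(m < n) first_return m.+1 d * walk e k (n - m) 0.
Proof.
elim: n d => [|n IHn] d.
  rewrite big_ord0 walkS /transfer /next_walk !walk0.
  by rewrite !mulr0 addr0 mulr0 addr0.
rewrite big_ord_recl subn0.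
under eq_bigr => m _ do rewrite lift0 subSS.
pose g m := next_walk (pred1 0) 0 m.+1.
(* A first step onto 0 gives the term split off from the sum, and every [g m] vanishes there;
   elsewhere the induction hypothesis applies. *)
have -> : walk e k.+1 n.+2 d = transfer (fun x =>
    (x == 0)%:R * walk e k n.+1 0 + \sum_(m < n) g m x * walk e k (n - m) 0) d.
  rewrite walkS; apply: eq_transfer => x; rewrite /g /next_walk /=.
  case: ifP => x0.
    by rewrite mul1r big1 ?addr0 // => m _; rewrite mul0r.
  by rewrite mul0r add0r -IHn.
have -> : first_return 1 d = transfer (fun x => (x == 0)%:R) d by [].
have E m : first_return m.+2 d = transfer (g m) d by [].
under eq_bigr => m _ do rewrite E.
rewrite /transfer.
under eq_bigr => m _ do
  rewrite mulrDl -[a * _ * _]mulrA -[b * _ * _]mulrA mulrDl.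
rewrite big_split /= -!mulr_sumr big_split /=.
ring.
Qed.

Definition even_int (d : int) : bool := ~~ odd `|d|%N.

(** Both sides obey the same recurrence. Continued to start 0, the right side vanishes because
    [kernel] is even, which matches the ban on interior zeros. *)
Lemma first_return_kernel (n d : nat) :
  first_return n.+1 d.+1%:Z = b * (kernel n d%:Z - kernel n d.+2%:Z).
Proof.
rewrite /first_return; elim: n d => [|n IHn] d.
  by rewrite walk_stepS /next_walk !walk0 /= mulr0 !add0r subr0.
rewrite walk_stepS !IHn; case: d => [|d].
  rewrite /next_walk /= addr0 !kernelS !sub0r !add0r (kernelN n 1).
  have -> : 2%:Z + 1 = 3 by [].
  have -> : 2%:Z - 1 = 1 by [].
  ring.
rewrite /next_walk /= IHn !kernelS.
have -> : d.+1%:Z + 1 = d.+2 by lia.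
have -> : d.+1%:Z - 1 = d by lia.
have -> : d.+3%:Z + 1 = d.+4 by lia.
have -> : d.+3%:Z - 1 = d.+2 by lia.
ring.
Qed.

(** With D = d + 1, reflection gives c_n(2j - D) - c_n(2j + D) for the end 2j > 0, and the sum over
    j telescopes to the right side. The proof checks the recurrence directly. *)
Lemma walk_survive (n d : nat) :
  walk (fun x => even_int x && (x != 0)) 0 n d.+1%:Z
    = \sum_(i < d.+1) kernel n (d.+1%:Z - (i + i)%:Z).
Proof.
set e := fun _ => _.
elim: n d => [|n IHn] d.
  under eq_bigr do rewrite kernel0.
  rewrite walk0 /e /even_int /= andbT negbK.
  have [od|ed] := boolP (odd d).
    have lt : (d.+1./2 < d.+1)%N by lia.
    rewrite (bigD1 (Ordinal lt)) //= big1 => [|i /eqP ni].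
      have -> : d.+1%:Z - (d.+1./2 + d.+1./2)%N%:Z == 0 by lia.
      by rewrite addr0.
    have ne : (i : nat) <> d.+1./2 by move=> E; apply: ni; apply: val_inj.
    by have -> : (d.+1%:Z - (i + i)%:Z == 0) = false by lia.
  rewrite big1 // => i _.
  by have -> : (d.+1%:Z - (i + i)%:Z == 0) = false by lia.
pose G (d : nat) := \sum_(i < d) kernel n (d%:Z - (i + i)%:Z).
have -> : walk e 0 n.+1 d.+1 = a * G d.+1 + b * (G d.+2 + G d).
  rewrite walk_stepS !IHn -/(G _) -/(G _); congr (_ + _ * (_ + _)).
  case: d => [|d]; last by rewrite /next_walk andbF IHn.
  (* [G 0] is an empty sum. The walk at 0 has no weight either: [e 0] fails if [n] is 0, and
     otherwise this zero is interior. *)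
  by rewrite /next_walk andbT /G big_ord0; case: n {IHn G}.
under eq_bigr do rewrite kernelS.
rewrite big_split /= -!mulr_sumr big_split /=; congr (_ + _ * _).
(* The sums shifted by 1 and -1 have [d.+1] terms each, while [G d.+2] and [G d] have [d.+2] and
   [d]: the term at -d changes sides. *)
rewrite {1}/G big_ord_recr [X in _ = _ + X]big_ord_recr /= /G.
rewrite -!addrA [kernel _ _ + _]addrC !addrA; congr (_ + _ + _).
- by apply: eq_bigr => i _; congr kernel; lia.
- by apply: eq_bigr => i _; congr kernel; lia.
- by congr kernel; lia.
Qed.

Lemma walkD (e e1 e2 : pred int) (k n : nat) (d : int) :
  (forall x, (e x)%:R = (e1 x)%:R + (e2 x)%:R :> R) ->
  walk e k n d = walk e1 k n d + walk e2 k n d.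
Proof.
move=> eD; elim: n k d => [|n IHn] k d.
  by case: k => [|k]; rewrite !walk0 /= ?addr0.
rewrite !walkS.
have E x : next_walk e k n x = next_walk e1 k n x + next_walk e2 k n x.
  rewrite /next_walk; case: k => [|k]; rewrite !IHn;
    by case: ifP; rewrite ?addr0.
by rewrite (eq_transfer _ _ d E) /transfer; ring.
Qed.

(** Ends at 0 contribute one copy of the first-return weight, and nonzero even ends contribute the
    other [n] copies. *)
Lemma walk_even0 (n : nat) :
  walk even_int 0 n.+1 0 = first_return n.+1 0 *+ n.+1.
Proof.
rewrite (walkD _ (pred1 0) (fun x => even_int x && (x != 0))); last first.
  move=> x /=; have [->|x0] := eqVneq x 0; first by rewrite addr0.
  by rewrite andbT add0r.
rewrite -/(first_return _ _).
set e := fun x => _.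
case: n => [|n].
  rewrite walkS /transfer /next_walk /= !walk0 /=.
  by rewrite !mulr0 addr0 mulr0 !addr0.
rewrite /first_return !walk_step0; first last.
- by move=> x /=; rewrite oppr_eq0.
- by move=> x; rewrite /e /even_int abszN oppr_eq0.
rewrite -/(first_return _ _).
(* From 1 the survival sum is the single term c_{n+1}(1), which [mulr_kernel] at d = 1 turns into
   first returns. *)
have -> : walk e 0 n.+1 1 = first_return n.+1 1 *+ n.+1.
  rewrite (walk_survive n.+1 0) big_ord_recl big_ord0 addr0 subr0.
  rewrite (first_return_kernel n 0).
  by have := mulr_kernel n 1; rewrite mul1r mulr_natl.
ring.
Qed.

(** * Generating functions, truncated at degree [N] *)

Lemma walk_series (e : pred int) (k N n : nat) : (0 < n <= N)%N ->
  walk e k n 0 =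
   ((\poly_(m < N.+1) (if m is m'.+1 then first_return m 0 else 0)) ^+ k
    * \poly_(m < N.+1) (if m is m'.+1 then walk e 0 m 0 else 0))`_n.
Proof.
(* Both constant coefficients are set to 0, so the two extreme terms of the convolution vanish, as
   the decomposition at the first zero requires. *)
set H := \poly_(_ < _) _; set G := \poly_(_ < _) _.
elim: k n => [|k IHk] [|n] // /andP[_ nN].
  by rewrite mul1r coef_poly ltnS nN.
rewrite walk_first_return exprS -mulrA coefM big_ord_recl big_ord_recr /=.
rewrite subnn coef0M [G`_0]coef_poly mulr0 mulr0 addr0.
rewrite [H`_0]coef_poly mul0r add0r; apply: eq_bigr => i _.
have lt_in := ltn_ord i.
rewrite coef_poly /bump /= add1n subSS -IHk; last by lia.
by have -> : (i.+1 < N.+1)%N by lia.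
Qed.

Lemma walk_even (k n : nat) : (0 < n)%N ->
  walk even_int k n 0 *+ k.+1 = walk (pred1 0) k n 0 *+ n.
Proof.
case: n => // n _.
rewrite !(@walk_series _ k n.+1) ?leqnn //.
set H := \poly_(_ < _) _.
transitivity (('X * (H ^+ k.+1)^`())`_n.+1); last first.
  by rewrite coefXM coef_deriv exprSr.
rewrite -coefMn; congr (_ : {poly R})`_ _.
(* This is the case k = 0, coefficient by coefficient. *)
have -> : \poly_(m < n.+2) (if m is _.+1 then walk even_int 0 m 0 else 0)
    = 'X * H^`().
  apply/polyP => -[|m]; rewrite coefXM coef_poly //= coef_deriv coef_poly.
  by case: ifP; rewrite ?mul0rn // walk_even0.
by rewrite mulrCA -mulrnAr [H ^+ k * _]mulrC deriv_exp.
Qed.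

End WeightedWalk.

Arguments walk {R}.
Arguments next_walk {R}.

(** * From pairs of lattice paths to walks *)

Lemma big_tuple_cons (V : nmodType) (T : finType) (n : nat)
    (F : n.+1.-tuple T -> V) :
  \sum_P F P = \sum_x \sum_(P : n.-tuple T) F (cons_tuple x P).
Proof.
rewrite pair_big /=.
rewrite (reindex (fun xP : T * n.-tuple T => cons_tuple xP.1 xP.2)) //=.
exists (fun P => (thead P, behead_tuple P)) => [[x P] _|P _] /=.
  by rewrite theadE; congr pair; apply: val_inj.
by rewrite [RHS]tuple_eta; apply: val_inj.
Qed.

Definition separation (d : int) (P Q : seq bool) : int :=
  d + (count id P)%:Z - (count id Q)%:Z.

Definition meetings (n : nat) (d : int) (P Q : seq bool) : nat :=
  \sum_(m < n) ((0 < m)%N && (separation d (take m P) (take m Q) == 0)).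

Lemma separation_cons (d : int) (x y : bool) (P Q : seq bool) :
  separation d (x :: P) (y :: Q)
    = separation (d + (x : nat)%:Z - (y : nat)%:Z) P Q.
Proof. rewrite /separation /=; lia. Qed.

Lemma meetings_cons (n : nat) (d : int) (x y : bool) (P Q : seq bool) :
  let d' := d + (x : nat)%:Z - (y : nat)%:Z in
  meetings n.+1 d (x :: P) (y :: Q)
    = (((0 < n)%N && (d' == 0)) + meetings n d' P Q)%N.
Proof.
move=> d'; rewrite /meetings big_ord_recl add0n.
under eq_bigr => m _ do rewrite lift0 /= separation_cons.
rewrite -/d'.
case: n => [|n]; first by rewrite !big_ord0.
rewrite !big_ord_recl /= !take0 add0n; congr addn.
by rewrite /separation /= addr0 subr0.
Qed.

(** Equal steps NN and EE keep the separation, with weight 1 + X^2; EN and NE change it by 1 and -1,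
    with weight X each. The induction removes the first step of both paths. *)
Lemma walk_paths (R : comNzRingType) (e : pred int) (k n : nat) (d : int) :
  walk (1 + 'X^2) ('X : {poly R}) e k n d
    = \sum_(P : n.-tuple bool) \sum_(Q : n.-tuple bool)
        if (meetings n d P Q == k) && e (separation d P Q)
        then 'X^(count id P + count id Q) else 0.
Proof.
elim: n k d => [|n IHn] k d.
  have E (V : nmodType) (F : 0.-tuple bool -> V) : \sum_P F P = F [tuple].
    by rewrite (bigD1 [tuple]) //= big1 ?addr0 // => P /eqP[]; apply: tuple0.
  rewrite !E /= /meetings big_ord0 eq_sym /separation /= addr0 subr0.
  by case: ifP.
pose next := next_walk (1 + 'X^2) ('X : {poly R}) e k n.
have nextE (x y : bool) :
  'X^(x + y) * next (d + (x : nat)%:Z - (y : nat)%:Z) =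
   \sum_(P : n.-tuple bool) \sum_(Q : n.-tuple bool)
        if (meetings n.+1 d (x :: P) (y :: Q) == k)
             && e (separation d (x :: P) (y :: Q))
        then 'X^(count id (x :: P) + count id (y :: Q)) else 0.
  set d' := _ - _.
  transitivity ('X^(x + y) *
    (\sum_(P : n.-tuple bool) \sum_(Q : n.-tuple bool)
        if (((0 < n)%N && (d' == 0)) + meetings n d' P Q == k)%N
             && e (separation d' P Q)
        then 'X^(count id P + count id Q) else 0 : {poly R})).
    congr (_ * _); rewrite /next /next_walk; clear next.
    case: ifP => [/andP[_ /eqP->]|_]; last exact: IHn.
    (* For k = 0 the meeting just made already exceeds the allowed number, so the sum is empty. *)
    case: k => [|k]; last exact: IHn.
    by rewrite big1 // => P _; rewrite big1.
  rewrite mulr_sumr; apply: eq_bigr => P _.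
  rewrite mulr_sumr; apply: eq_bigr => Q _.
  rewrite meetings_cons separation_cons -/d' /=.
  case: ifP => _; last by rewrite mulr0.
  by rewrite -exprD; congr 'X^_; lia.
transitivity (\sum_x \sum_(P : n.-tuple bool) \sum_y \sum_(Q : n.-tuple bool)
  if (meetings n.+1 d (x :: P) (y :: Q) == k)
       && e (separation d (x :: P) (y :: Q))
  then 'X^(count id (x :: P) + count id (y :: Q)) else 0 : {poly R});
  last first.
  rewrite big_tuple_cons; apply: eq_bigr => x _; apply: eq_bigr => P _.
  by rewrite big_tuple_cons.
under eq_bigr => x _.
  rewrite exchange_big /=; under eq_bigr => y _ do rewrite -nextE.
  over.
rewrite walkS -/next /transfer !big_bool /=.
rewrite ?addrK ?subr0 ?addr0 expr0 mul1r mulrDl mul1r mulrDr -!addrA.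
by rewrite [next d + _]addrC -!addrA.
Qed.

Lemma coef_walk_paths (R : comNzRingType) (e : pred int) (k n T : nat) :
  (walk (1 + 'X^2) ('X : {poly R}) e k n 0)`_T
    = #|[set PQ : lattice_path n * lattice_path n |
          [&& meetings n 0 PQ.1 PQ.2 == k, e (separation 0 PQ.1 PQ.2)
            & count id PQ.1 + count id PQ.2 == T]]|%:R.
Proof.
rewrite walk_paths pair_big /= coef_sum -sum1dep_card natr_sum.
rewrite [RHS]big_mkcond /=; apply: eq_bigr => PQ _.
rewrite andbA eq_sym; case: (_ && e _); last by rewrite coef0.
by rewrite coefXn /= [in LHS]eq_sym; case: eqP.
Qed.

Lemma position_count (n : nat) (P : lattice_path n) (m : nat) : (m <= n)%N ->
  position P m = ((count id (take m P))%:Z, m%:Z - (count id (take m P))%:Z).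
Proof.
move=> mn; rewrite /position.
have: size (take m P) = m by rewrite size_takel // size_tuple.
move: (take m P) => s; clear mn; elim: s m => [|x s IHs] m /= <-.
  by rewrite big_nil.
rewrite big_cons (IHs _ erefl) /step; congr pair.
all: by case: x => /=; lia.
Qed.

Lemma position_eq (n : nat) (P Q : lattice_path n) (m : nat) : (m <= n)%N ->
  (position P m == position Q m) = (separation 0 (take m P) (take m Q) == 0).
Proof.
move=> mn; rewrite !position_count // xpair_eqE /separation; lia.
Qed.

Lemma position_end (n : nat) (P : lattice_path n) (r : int) :
  (position P n == (r, n%:Z - r)) = ((count id P)%:Z == r).
Proof.
rewrite position_count // take_oversize ?size_tuple // xpair_eqE; lia.
Qed.

Lemma intersections_meetings (n : nat) (P Q : lattice_path n) :
  intersections P Q = meetings n 0 P Q.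
Proof.
rewrite /intersections /meetings -sum1dep_card big_mkcond /=.
by apply: eq_bigr => m _; rewrite position_eq ?(ltnW (ltn_ord m)) //; case: ifP.
Qed.

Lemma N_same_walk (n k p : nat) :
  (N_same n k p)%:R
    = (walk (1 + 'X^2) ('X : {poly rat}) (pred1 0) k n 0)`_(p + p).
Proof.
rewrite coef_walk_paths /N_same /M; congr (_%:R); apply: eq_card => -[P Q].
rewrite !inE /= !position_end intersections_meetings /separation.
case: (_ == k); lia.
Qed.

Lemma N_E_card (n k : nat) (p : int) :
  N_E n k p = #|[set PQ : lattice_path n * lattice_path n |
    (intersections PQ.1 PQ.2 == k)
      && ((count id PQ.1)%:Z + (count id PQ.2)%:Z == 2 * p)]|.
Proof.
have count_lt (P : lattice_path n) : (count id P < n.+1)%N.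
  by rewrite ltnS -[X in (_ <= X)%N](size_tuple P) count_size.
pose ends (P : lattice_path n) : 'I_n.+1 := Ordinal (count_lt P).
rewrite -sum1dep_card.
rewrite (partition_big (fun PQ => ends PQ.1) xpredT) //=.
apply: eq_bigr => r _.
rewrite (partition_big (fun PQ => ends PQ.2)
  (fun s : 'I_n.+1 => r%:Z + s%:Z == 2 * p)) /=; last first.
  by move=> PQ /andP[/andP[_ E] /eqP <-].
apply: eq_bigr => s rs; rewrite sum1dep_card; apply: eq_card => -[P Q].
rewrite !inE /= !position_end -!val_eqE /=.
by case: (_ == k); lia.
Qed.

(** The two E counts have an even sum exactly when their difference is even, so a total of 2p
    matches an even end of the walk. *)
Lemma N_E_walk (n k p : nat) :
  (N_E n k p)%:R
    = (walk (1 + 'X^2) ('X : {poly rat}) even_int k n 0)`_(p + p).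
Proof.
rewrite coef_walk_paths N_E_card; congr (_%:R); apply: eq_card => -[P Q].
rewrite !inE /= intersections_meetings /separation /even_int.
case: (_ == k); lia.
Qed.

Theorem theorem1 (n k : nat) (p : int) (hn : (1 <= n)%N) :
  (N_E n k p)%:R = n%:R / k.+1%:R * (N_same n k p)%:R :> rat.
Proof.
(* For negative [p] no pair of paths qualifies and both counts are 0. *)
case: p => p; last first.
  have -> : N_E n k (Negz p) = 0%N.
    by rewrite N_E_card; apply: eq_card0 => -[P Q]; rewrite !inE /=; lia.
  have -> : N_same n k (Negz p) = 0%N; last by rewrite mulr0.
  by apply: eq_card0 => -[P Q]; rewrite !inE /= !position_end; lia.
have k1 : k.+1%:R != 0 :> rat by rewrite pnatr_eq0.
apply: (mulIf k1); rewrite mulrAC divfK // N_E_walk N_same_walk.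
by rewrite mulr_natr mulr_natl -!coefMn walk_even.
Qed.
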